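(* Let $\lambda\in F$, $\lambda\neq 0$. Each of the following linear operators $R$ on $H_4$ is a Rota--Baxter operator of weight $\lambda$, and every non-trivial Rota--Baxter operator of weight $\lambda$ on $H_4$ is, up to conjugation and dualization, one of them: (1) $R(1)=0$, $R(g)=0$, $R(x)=\alpha 1+\alpha g-\lambda x$, $R(gx)=\alpha 1+\alpha g-\lambda gx$, for some $\alpha\in F$, $\alpha\neq 0$; (2) $R(1)=0$, $R(g)=-\lambda 1-\lambda g$, $R(x)=0$, $R(gx)=-\lambda x-\lambda gx$; (3) $R(1)=0$, $R(g)=-\lambda 1-\lambda g$, $R(x)=-\frac{\lambda}{2}x-\frac{\lambda}{2}gx$, $R(gx)=-\frac{\lambda}{2}x-\frac{\lambda}{2}gx$; (4) $R(1)=-\lambda 1$, $R(g)=-\lambda g$, $R(x)=0$, $R(gx)=0$; (5) $R(1)=-\frac{3\lambda}{2}1-\frac{\lambda}{2}g$, $R(g)=\frac{\lambda}{2}1-\frac{\lambda}{2}g$, $R(x)=0$, $R(gx)=0$; (6) $R(1)=R(g)=-\frac{\lambda}{2}1-\frac{\lambda}{2}g$, $R(x)=R(gx)=-\frac{\lambda}{2}x-\frac{\lambda}{2}gx$; (7) $R(1)=R(g)=\frac{\lambda}{2}1-\frac{\lambda}{2}g$, $R(x)=R(gx)=-\frac{\lambda}{2}x-\frac{\lambda}{2}gx$; (8) $R(1)=R(g)=-\lambda 1$, $R(x)=R(gx)=0$; (9) $R(1)=R(g)=-\frac{\lambda}{2}1-\frac{\lambda}{2}g$, $R(x)=R(gx)=0$;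 (10) $R(1)=R(g)=\frac{\lambda}{2}1-\frac{\lambda}{2}g$, $R(x)=R(gx)=0$; (11) $R(1)=0$, $R(g)=-\lambda 1-\lambda g$, $R(x)=R(gx)=0$; (12) $R(1)=R(g)=-\lambda 1$, $R(x)=\alpha 1-\alpha g-\lambda x$, $R(gx)=\alpha 1-\alpha g-\lambda gx$, for some $\alpha\in F$, $\alpha\neq 0$; (13) $R(1)=-\lambda 1$, $R(g)=-\lambda g$, $R(x)=R(gx)=-\frac{\lambda}{2}x-\frac{\lambda}{2}gx$; (14) $R(1)=-\lambda 1$, $R(g)=-\lambda g$, $R(x)=0$, $R(gx)=\lambda x-\lambda gx$.
   Context: $F$ is a field with $\operatorname{char}(F)\neq 2$. The Sweedler algebra $H_4$ is the four-dimensional associative unital $F$-algebra generated by $x,g$ subject to $x^2=0$, $g^2=1$, $gx=-xg$; it has basis $\{1,g,x,gx\}$. A linear operator $R$ on an $F$-algebra $A$ is a Rota--Baxter operator of weight $\lambda\in F$ if $R(a)R(b)=R\bigl(R(a)b+aR(b)+\lambda ab\bigr)$ for all $a,b\in A$. The operators $0$ and $-\lambda\operatorname{id}$ are called trivial. The dual of $R$ is the operator $-\lambda\operatorname{id}-R$. A conjugate of $R$ is an operator $\varphi^{-1}R\varphi$ with $\varphi$ an automorphism or antiautomorphism of the $F$-algebra $H_4$ (disregarding any Hopf structure). Both operations preserve Rota--Baxter operators of weight $\lambda$. ''Up to conjugation and dualization, $R$ is one of the operators in the list'' means that $R$ or its dual is a conjugate of an operator in the list. *)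

(* Defs.v *)
From HB Require Import structures.
From mathcomp Require Import all_boot all_order all_algebra all_field ring.

Set Implicit Arguments.
Unset Strict Implicit.
Unset Printing Implicit Defensive.

Import GRing.Theory.
Local Open Scope ring_scope.

(* The Sweedler algebra, as row vectors of coordinates in the basis           *)
(* 1, g, x, g x.  The multiplication table is forced by x^2 = 0, g^2 = 1 and  *)
(* g x = - x g; the lemmas sw_relations and sw_basis below check that the     *)
(* type is the algebra with this presentation and this basis.                 *)
Definition sweedler (F : fieldType) : Type := 'rV[F]_4.

HB.instance Definition _ (F : fieldType) := Vector.copy (sweedler F) 'rV[F]_4.

Definition sw (F : fieldType) (a b c d : F) : sweedler F :=
  \row_(i < 4) [:: a; b; c; d]`_i.

Definition sw_coord (F : fieldType) (u : sweedler F) (i : nat) : F :=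
  (u : 'rV[F]_4) 0 (inord i).

Definition sw_mul (F : fieldType) (u v : sweedler F) : sweedler F :=
  let: (a, b) := (sw_coord u 0, sw_coord u 1) in
  let: (c, d) := (sw_coord u 2, sw_coord u 3) in
  let: (a', b') := (sw_coord v 0, sw_coord v 1) in
  let: (c', d') := (sw_coord v 2, sw_coord v 3) in
  sw (a * a' + b * b') (a * b' + b * a')
     (a * c' + c * a' + b * d' - d * b') (a * d' + d * a' + b * c' - c * b').

Definition sw_one (F : fieldType) : sweedler F := sw 1 0 0 0.
Definition sw_g (F : fieldType) : sweedler F := sw 0 1 0 0.
Definition sw_x (F : fieldType) : sweedler F := sw 0 0 1 0.

Section SweedlerAlgebra.
Variable F : fieldType.
Implicit Types (u v w : sweedler F) (a b c d k : F).

Lemma swP u : exists a b c d, u = sw a b c d.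
Proof.
exists (sw_coord u 0), (sw_coord u 1), (sw_coord u 2), (sw_coord u 3).
apply/rowP => i; rewrite mxE.
by case: i => -[|[|[|[|//]]]] i_lt; rewrite /= /sw_coord; congr (u _ _);
   apply/val_inj; rewrite /= inordK.
Qed.

Lemma sw_mulE a b c d a' b' c' d' :
  sw_mul (sw a b c d) (sw a' b' c' d') =
  sw (a * a' + b * b') (a * b' + b * a')
     (a * c' + c * a' + b * d' - d * b') (a * d' + d * a' + b * c' - c * b').
Proof. by rewrite /sw_mul /sw_coord !mxE !inordK. Qed.

Lemma sw_addE a b c d a' b' c' d' :
  sw a b c d + sw a' b' c' d' = sw (a + a') (b + b') (c + c') (d + d').
Proof.
by apply/rowP => i; rewrite !mxE; case: i => -[|[|[|[|//]]]] i_lt.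
Qed.

Lemma sw_scaleE k a b c d :
  k *: sw a b c d = sw (k * a) (k * b) (k * c) (k * d).
Proof.
by apply/rowP => i; rewrite !mxE; case: i => -[|[|[|[|//]]]] i_lt.
Qed.

Lemma sw_inj a b c d a' b' c' d' :
  sw a b c d = sw a' b' c' d' -> [/\ a = a', b = b', c = c' & d = d'].
Proof.
move=> /rowP eq_sw.
by split; [have := eq_sw (inord 0) | have := eq_sw (inord 1)
  | have := eq_sw (inord 2) | have := eq_sw (inord 3)]; rewrite !mxE !inordK.
Qed.

Lemma sw0E : 0 = sw 0 0 0 0 :> sweedler F.
Proof.
by apply/rowP => i; rewrite !mxE; case: i => -[|[|[|[|//]]]] i_lt.
Qed.

Fact sw_mulA : associative (@sw_mul F).
Proof.
move=> u v w.
have [a [b [c [d ->]]]] := swP u; have [a' [b' [c' [d' ->]]]] := swP v.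
have [a'' [b'' [c'' [d'' ->]]]] := swP w.
by rewrite !sw_mulE; congr sw; ring.
Qed.

Fact sw_mul1 : left_id (@sw_one F) (@sw_mul F).
Proof.
by move=> u; have [a [b [c [d ->]]]] := swP u; rewrite sw_mulE; congr sw; ring.
Qed.

Fact sw_mulr1 : right_id (@sw_one F) (@sw_mul F).
Proof.
by move=> u; have [a [b [c [d ->]]]] := swP u; rewrite sw_mulE; congr sw; ring.
Qed.

Fact sw_mulDl : left_distributive (@sw_mul F) +%R.
Proof.
move=> u v w.
have [a [b [c [d ->]]]] := swP u; have [a' [b' [c' [d' ->]]]] := swP v.
have [a'' [b'' [c'' [d'' ->]]]] := swP w.
by rewrite !(sw_addE, sw_mulE); congr sw; ring.
Qed.

Fact sw_mulDr : right_distributive (@sw_mul F) +%R.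
Proof.
move=> u v w.
have [a [b [c [d ->]]]] := swP u; have [a' [b' [c' [d' ->]]]] := swP v.
have [a'' [b'' [c'' [d'' ->]]]] := swP w.
by rewrite !(sw_addE, sw_mulE); congr sw; ring.
Qed.

Fact sw_one_neq0 : sw_one F != 0.
Proof.
by apply/eqP; rewrite sw0E => /sw_inj [/eqP]; rewrite oner_eq0.
Qed.

HB.instance Definition _ := GRing.Zmodule_isNzRing.Build (sweedler F)
  sw_mulA sw_mul1 sw_mulr1 sw_mulDl sw_mulDr sw_one_neq0.

Lemma sw1E : 1 = sw 1 0 0 0 :> sweedler F.
Proof. by []. Qed.

Lemma sw_mulrE a b c d a' b' c' d' :
  sw a b c d * sw a' b' c' d' =
  sw (a * a' + b * b') (a * b' + b * a')
     (a * c' + c * a' + b * d' - d * b') (a * d' + d * a' + b * c' - c * b').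
Proof. exact: sw_mulE. Qed.

Fact sw_scaleAl k u v : k *: (u * v) = (k *: u) * v.
Proof.
have [a [b [c [d ->]]]] := swP u; have [a' [b' [c' [d' ->]]]] := swP v.
by rewrite !(sw_scaleE, sw_mulrE); congr sw; ring.
Qed.

HB.instance Definition _ :=
  GRing.Lmodule_isLalgebra.Build F (sweedler F) sw_scaleAl.

Fact sw_scaleAr k u v : k *: (u * v) = u * (k *: v).
Proof.
have [a [b [c [d ->]]]] := swP u; have [a' [b' [c' [d' ->]]]] := swP v.
by rewrite !(sw_scaleE, sw_mulrE); congr sw; ring.
Qed.

HB.instance Definition _ :=
  GRing.Lalgebra_isAlgebra.Build F (sweedler F) sw_scaleAr.

HB.instance Definition _ := Algebra_isFalgebra.Build F (sweedler F).

Local Notation g := (sw_g F).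
Local Notation x := (sw_x F).

Lemma sw_relations : [/\ x * x = 0, g * g = 1 & g * x = - (x * g)].
Proof.
split; rewrite !sw_mulrE.
- by rewrite sw0E; congr sw; ring.
- by rewrite sw1E; congr sw; ring.
- by rewrite -scaleN1r sw_scaleE; congr sw; ring.
Qed.

Lemma swE a b c d : sw a b c d = a *: 1 + b *: g + c *: x + d *: (g * x).
Proof.
by rewrite sw1E sw_mulrE !sw_scaleE !sw_addE; congr sw; ring.
Qed.

Lemma sw_basis : basis_of fullv [tuple 1; g; x; g * x].
Proof.
rewrite basisEdim; apply/andP; split; last by rewrite dimvf.
apply/subvP => u _; have [a [b [c [d ->]]]] := swP u; rewrite swE.
by rewrite !rpredD // rpredZ // memv_span // !inE eqxx ?orbT.
Qed.

End SweedlerAlgebra.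

Section RotaBaxter.
Variables (F : fieldType) (A : falgType F).
Implicit Types (lambda : F) (R S phi : 'End(A)).

Definition rota_baxter lambda R : Prop :=
  forall a b : A, R a * R b = R (R a * b + a * R b + lambda *: (a * b)).

Definition rb_trivial lambda R : Prop :=
  R = 0 \/ R = - (lambda *: \1%VF).

Definition rb_dual lambda R : 'End(A) := - (lambda *: \1%VF) - R.

Definition algebra_aut phi : Prop :=
  [/\ bijective phi, phi 1 = 1 & forall a b : A, phi (a * b) = phi a * phi b].

Definition algebra_antiaut phi : Prop :=
  [/\ bijective phi, phi 1 = 1 & forall a b : A, phi (a * b) = phi b * phi a].

(* phi^-1 is the inverse for composition of linear maps, and                  *)
(* (f \o g) a = f (g a).                                                      *)
Definition conjugate_of S R : Prop :=
  exists phi : 'End(A), (algebra_aut phi \/ algebra_antiaut phi) /\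
    R = (phi^-1 \o S \o phi)%VF.

End RotaBaxter.

Section List.
Variable F : fieldType.

Local Notation H4 := (sweedler F).
Local Notation g := (sw_g F).
Local Notation x := (sw_x F).
Local Notation gx := (sw_g F * sw_x F).

Definition sw_values (R : 'End(H4)) (r1 rg rx rgx : H4) : Prop :=
  [/\ R 1 = r1, R g = rg, R x = rx & R gx = rgx].

Lemma sw_values_exists (r1 rg rx rgx : H4) :
  exists! R : 'End(H4), sw_values R r1 rg rx rgx.
Proof.
have B := sw_basis F; have freeB := basis_free B.
pose s := [:: r1; rg; rx; rgx].
pose X : 4.-tuple H4 := [tuple 1; g; x; gx].
pose f (u : H4) : H4 := \sum_(i < 4) coord X i u *: s`_i.
have f_lin : linear f.
  move=> k u v; rewrite /f scaler_sumr -big_split /=; apply: eq_bigr => i _.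
  by rewrite linearP scalerDl scalerA.
pose fM := GRing.isLinear.Build F H4 H4 _ f f_lin.
pose fL : {linear H4 -> H4} := HB.pack f fM.
have fX (i : 'I_4) : linfun fL X`_i = s`_i.
  rewrite lfunE /= /f (bigD1 i) //= coord_free // eqxx scale1r big1 ?addr0 //.
  by move=> j /negPf ji; rewrite coord_free // eq_sym ji scale0r.
exists (linfun fL); split=> [|R [R1 Rg Rx Rgx]].
  by split; [have := fX (@Ordinal 4 0 isT) | have := fX (@Ordinal 4 1 isT)
    | have := fX (@Ordinal 4 2 isT) | have := fX (@Ordinal 4 3 isT)].
apply/lfunP => u; rewrite (coord_basis B (memvf u)) !linear_sum /=.
apply: eq_bigr => i _; rewrite !linearZ /= fX; congr (_ *: _).
by case: i => -[|[|[|[|//]]]] i_lt.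
Qed.

Variable lambda : F.

Inductive rb_list (R : 'End(H4)) : Prop :=
| RB1 (alpha : F) of alpha != 0 & sw_values R
    0
    0
    (alpha *: 1 + alpha *: g - lambda *: x)
    (alpha *: 1 + alpha *: g - lambda *: gx)
| RB2 of sw_values R
    0
    (- (lambda *: 1) - lambda *: g)
    0
    (- (lambda *: x) - lambda *: gx)
| RB3 of sw_values R
    0
    (- (lambda *: 1) - lambda *: g)
    (- ((lambda / 2) *: x) - (lambda / 2) *: gx)
    (- ((lambda / 2) *: x) - (lambda / 2) *: gx)
| RB4 of sw_values R
    (- (lambda *: 1))
    (- (lambda *: g))
    0
    0
| RB5 of sw_values R
    (- ((3 * lambda / 2) *: 1) - (lambda / 2) *: g)
    ((lambda / 2) *: 1 - (lambda / 2) *: g)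
    0
    0
| RB6 of sw_values R
    (- ((lambda / 2) *: 1) - (lambda / 2) *: g)
    (- ((lambda / 2) *: 1) - (lambda / 2) *: g)
    (- ((lambda / 2) *: x) - (lambda / 2) *: gx)
    (- ((lambda / 2) *: x) - (lambda / 2) *: gx)
| RB7 of sw_values R
    ((lambda / 2) *: 1 - (lambda / 2) *: g)
    ((lambda / 2) *: 1 - (lambda / 2) *: g)
    (- ((lambda / 2) *: x) - (lambda / 2) *: gx)
    (- ((lambda / 2) *: x) - (lambda / 2) *: gx)
| RB8 of sw_values R
    (- (lambda *: 1))
    (- (lambda *: 1))
    0
    0
| RB9 of sw_values R
    (- ((lambda / 2) *: 1) - (lambda / 2) *: g)
    (- ((lambda / 2) *: 1) - (lambda / 2) *: g)
    0
    0
| RB10 of sw_values R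
    ((lambda / 2) *: 1 - (lambda / 2) *: g)
    ((lambda / 2) *: 1 - (lambda / 2) *: g)
    0
    0
| RB11 of sw_values R
    0
    (- (lambda *: 1) - lambda *: g)
    0
    0
| RB12 (alpha : F) of alpha != 0 & sw_values R
    (- (lambda *: 1))
    (- (lambda *: 1))
    (alpha *: 1 - alpha *: g - lambda *: x)
    (alpha *: 1 - alpha *: g - lambda *: gx)
| RB13 of sw_values R
    (- (lambda *: 1))
    (- (lambda *: g))
    (- ((lambda / 2) *: x) - (lambda / 2) *: gx)
    (- ((lambda / 2) *: x) - (lambda / 2) *: gx)
| RB14 of sw_values R
    (- (lambda *: 1))
    (- (lambda *: g))
    0
    (lambda *: x - lambda *: gx).

End List.

(* Main.v *)
Require Import Defs.
From HB Require Import structures.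
From mathcomp Require Import all_boot all_order all_algebra all_field ring.

Set Implicit Arguments.
Unset Strict Implicit.
Unset Printing Implicit Defensive.

Import GRing.Theory.
Local Open Scope ring_scope.

(** After rescaling the operator the weight may be taken to be -1, so that the
    dual of P is 1 - P.  Put e = (1 + g)/2, f = (1 - g)/2, y = e x and z = f x:
    these are the two idempotents and the two arrows of a quiver algebra, with
    e y = y = y f, f z = z = z e and all products of two arrows zero; y and z
    span the radical J.  Every symmetry used is a product of three kinds: the
    automorphisms that rescale y and z and conjugate by 1 + j with j in J
    (gauge_exists), the automorphism exchanging e with f and y with z
    (swap_exists), and the antiautomorphism exchanging y with z
    (flip_exists).

    Suppose first that P does not preserve J, so that P(y) or P(z) has a nonzero
    coordinate along e or f.  A symmetry moves it to the coordinate of P(y)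
    along e; the law on (y, y) then makes the coordinate of P(y) along f zero,
    and a gauge automorphism turns P(y) into e.  The law then determines P up to
    two idempotent scalars (unstable_normal_form), and the resulting four
    operators are, up to duality and conjugation, two: they give the families
    RB1 and RB12 (classified_unstable).

    If P preserves J, it induces a Rota-Baxter operator on H4/J, which is F x F;
    up to symmetry and duality that operator maps (e, f) to (0, 0), (e, 0),
    (1, 0) or (1, f).  In each case the radical parts of P(e) and P(f) are
    removed by conjugating with a suitable 1 + j (classified_inner_conj).  What
    remains is the restriction T of P to J.  For (0, 0) and (1, 0) the law says
    that T is idempotent with a kernel that is stable under multiplication by e
    (projection_cases); for (e, 0) and (1, f) it says that T is diagonal and
    idempotent.  The finitely many outcomes are matched with the remaining
    members of the list. *)

(** * Symmetries, duality and scaling *)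

Section Symmetries.
Variables (F : fieldType) (A : falgType F).
Implicit Types (k lambda : F) (P R S phi psi : 'End(A)).

Definition symmetry phi := algebra_aut phi \/ algebra_antiaut phi.

Lemma symmetry_bij phi : symmetry phi -> bijective phi.
Proof. by case=> -[]. Qed.

Lemma bijective_lker0 phi : bijective phi -> lker phi == 0%VS.
Proof. by move=> /bij_inj inj_phi; apply/lker0P. Qed.

Lemma symmetryV phi : symmetry phi -> symmetry phi^-1%VF.
Proof.
move=> sym_phi; have ker0 := bijective_lker0 (symmetry_bij sym_phi).
have phiK : cancel phi phi^-1%VF := lker0_lfunK ker0.
have phiVK : cancel phi^-1%VF phi := lker0_lfunVK ker0.
have bijV : bijective phi^-1%VF by exists phi.
case: sym_phi => -[_ phi1 phiM]; [left | right]; split=> //.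
- by rewrite -phi1 phiK.
- by move=> u v; apply: (can_inj phiK); rewrite phiM !phiVK.
- by rewrite -phi1 phiK.
- by move=> u v; apply: (can_inj phiK); rewrite phiM !phiVK.
Qed.

Lemma symmetry_comp phi psi :
  symmetry phi -> symmetry psi -> symmetry (phi \o psi)%VF.
Proof.
have comp_bij (f h : 'End(A)) :
    bijective f -> bijective h -> bijective (f \o h)%VF.
  move=> bij_f bij_h; apply: (eq_bij (bij_comp bij_f bij_h)) => u.
  by rewrite comp_lfunE.
case=> -[bij1 one1 mul1] [] [bij2 one2 mul2];
  [left | right | right | left]; split; do ?exact: comp_bij;
  by rewrite ?comp_lfunE ?one2 ?one1 // => u v; rewrite !comp_lfunE mul2 mul1.
Qed.

Lemma conjugate_of_intertwining phi S R : symmetry phi ->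
  (forall u, phi (R u) = S (phi u)) -> conjugate_of S R.
Proof.
move=> sym_phi phiR; exists phi; split=> //.
have ker0 := bijective_lker0 (symmetry_bij sym_phi).
by apply/lfunP => u; rewrite !comp_lfunE -phiR lker0_lfunK.
Qed.

(** Conjugacy to S only depends on the conjugacy class: phi transports the
    conjugating map of P' to one of P. *)
Lemma conjugate_of_pull phi S P P' : symmetry phi ->
  (forall u, phi (P' u) = P (phi u)) -> conjugate_of S P' -> conjugate_of S P.
Proof.
move=> sym_phi phiP [psi [sym_psi eP']].
have ker0 := bijective_lker0 (symmetry_bij sym_phi).
have ker0' := bijective_lker0 (symmetry_bij sym_psi).
apply: (@conjugate_of_intertwining (psi \o phi^-1)%VF).
  exact: symmetry_comp sym_psi (symmetryV sym_phi).
move=> u; rewrite !comp_lfunE -{1}(lker0_lfunVK ker0 u) -phiP lker0_lfunK //.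
by rewrite eP' !comp_lfunE lker0_lfunVK.
Qed.

Lemma rota_baxter_dual lambda R :
  rota_baxter lambda R -> rota_baxter lambda (rb_dual lambda R).
Proof.
move=> RB u v; rewrite /rb_dual.
have dualE w : (- (lambda *: \1%VF) - R) w = - (lambda *: w + R w).
  by rewrite !(add_lfunE, opp_lfunE, scale_lfunE, id_lfunE) opprD.
rewrite !{}dualE mulrNN !mulNr !mulrN.
set c := R u * v + u * R v + lambda *: (u * v).
have -> : - ((lambda *: u + R u) * v) - u * (lambda *: v + R v) +
    lambda *: (u * v) = - c.
  rewrite mulrDl mulrDr -scalerAl -scalerAr !opprD [- _ + - (u * R v)]addrC.
  by rewrite addrA addrNK -addrA addrC.
rewrite !linearN -opprD opprK mulrDl !mulrDr RB -/c addrA; congr (_ + _).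
rewrite /= /c !scalerDr -!scalerAl -!scalerAr.
by rewrite addrC [X in _ + X = _]addrC addrA.
Qed.

Lemma rb_dualK lambda R : rb_dual lambda (rb_dual lambda R) = R.
Proof. by rewrite /rb_dual opprB addrCA subrr addr0. Qed.

Lemma rota_baxter_conj lambda phi R : symmetry phi -> rota_baxter lambda R ->
  rota_baxter lambda (phi^-1 \o R \o phi)%VF.
Proof.
move=> sym_phi RB u v.
have ker0 := bijective_lker0 (symmetry_bij sym_phi).
have phiVK : cancel phi^-1%VF phi := lker0_lfunVK ker0.
have phiR w : phi ((phi^-1 \o R \o phi)%VF w) = R (phi w).
  by rewrite !comp_lfunE phiVK.
set P := (phi^-1 \o R \o phi)%VF in phiR *.
apply: (can_inj (lker0_lfunK ker0)); rewrite phiR.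
have -> : phi (P u * v + u * P v + lambda *: (u * v)) =
    phi (P u * v) + phi (u * P v) + lambda *: phi (u * v).
  by rewrite !linearD linearZ.
case: sym_phi => -[_ _ phiM]; rewrite !phiM !phiR RB //.
by congr (R (_ + _)); rewrite addrC.
Qed.

Lemma rota_baxter_scale k lambda R :
  rota_baxter lambda R -> rota_baxter (k * lambda) (k *: R).
Proof.
move=> RB u v; rewrite !scale_lfunE.
have -> : k *: R u * v + u * (k *: R v) + k * lambda *: (u * v) =
    k *: (R u * v + u * R v + lambda *: (u * v)).
  by rewrite -scalerAl -scalerAr -[in LHS]scalerA -!scalerDr.
by rewrite linearZ -scalerAl -scalerAr RB.
Qed.

Lemma rb_dual_scale k lambda R :
  rb_dual (k * lambda) (k *: R) = k *: rb_dual lambda R.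
Proof. by rewrite /rb_dual scalerBr scalerN scalerA. Qed.

Lemma rb_trivial_scale k lambda R :
  rb_trivial lambda R -> rb_trivial (k * lambda) (k *: R).
Proof.
case=> ->; [left | right]; first by rewrite scaler0.
by rewrite scalerN scalerA.
Qed.

Lemma conjugate_of_scale k S R :
  conjugate_of S R -> conjugate_of (k *: S) (k *: R).
Proof.
move=> [phi [sym_phi ->]]; exists phi; split=> //.
by apply/lfunP => u; rewrite !(scale_lfunE, comp_lfunE) linearZ.
Qed.

End Symmetries.

(** * Peirce coordinates *)

Section PeirceCoordinates.
Variable F : fieldType.
Hypothesis two_neq0 : 2 != 0 :> F.
Local Notation H4 := (sweedler F).
Implicit Types (P S phi : 'End(H4)).

(** The element a e + b f + c y + d z, where e and f are (1 + g)/2 and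
    (1 - g)/2, y is e x and z is f x. *)
Definition peirce (a b c d : F) : H4 :=
  sw ((a + b) / 2) ((a - b) / 2) ((c + d) / 2) ((c - d) / 2).

Local Notation e := (peirce 1 0 0 0).
Local Notation f := (peirce 0 1 0 0).
Local Notation y := (peirce 0 0 1 0).
Local Notation z := (peirce 0 0 0 1).

Lemma sw_peirce a b c d :
  sw a b c d = peirce (a + b) (a - b) (c + d) (c - d) :> H4.
Proof. by congr sw; field. Qed.

Lemma sw_oppE (a b c d : F) : - sw a b c d = sw (- a) (- b) (- c) (- d).
Proof. by rewrite -scaleN1r sw_scaleE; congr sw; ring. Qed.

Lemma peirce_span (u : H4) : exists a b c d, u = peirce a b c d.
Proof.
have [a [b [c [d ->]]]] := swP u.
by exists (a + b), (a - b), (c + d), (c - d); rewrite sw_peirce.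
Qed.

Lemma peirce_inj a b c d a' b' c' d' :
  peirce a b c d = peirce a' b' c' d' -> [/\ a = a', b = b', c = c' & d = d'].
Proof.
have half_sum (s t : F) : s = (s + t) / 2 + (s - t) / 2 by field.
have half_diff (s t : F) : t = (s + t) / 2 - (s - t) / 2 by field.
case/sw_inj => ab_sum ab_diff cd_sum cd_diff; split.
- by rewrite (half_sum a b) ab_sum ab_diff -half_sum.
- by rewrite (half_diff a b) ab_sum ab_diff -half_diff.
- by rewrite (half_sum c d) cd_sum cd_diff -half_sum.
- by rewrite (half_diff c d) cd_sum cd_diff -half_diff.
Qed.

Lemma peirce_mulE a b c d a' b' c' d' :
  peirce a b c d * peirce a' b' c' d' =
  peirce (a * a') (b * b') (a * c' + c * b') (b * d' + d * a').
Proof. by rewrite sw_mulrE; congr sw; field. Qed.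

Lemma peirce_addE a b c d a' b' c' d' :
  peirce a b c d + peirce a' b' c' d' =
  peirce (a + a') (b + b') (c + c') (d + d').
Proof. by rewrite sw_addE; congr sw; field. Qed.

Lemma peirce_scaleE k a b c d :
  k *: peirce a b c d = peirce (k * a) (k * b) (k * c) (k * d).
Proof. by rewrite sw_scaleE; congr sw; field. Qed.

Lemma peirce_oppE a b c d : - peirce a b c d = peirce (- a) (- b) (- c) (- d).
Proof. by rewrite -scaleN1r peirce_scaleE; congr peirce; ring. Qed.

Lemma peirce0E : 0 = peirce 0 0 0 0.
Proof. by rewrite sw0E; congr sw; field. Qed.

Lemma peirce1E : 1 = peirce 1 1 0 0.
Proof. by rewrite sw1E; congr sw; field. Qed.

Definition peirceE := (peirce_addE, peirce_mulE, peirce_scaleE, peirce_oppE).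

Definition peirce_values P (ve vf vy vz : H4) :=
  [/\ P e = ve, P f = vf, P y = vy & P z = vz].

Lemma peirce_values_exists ve vf vy vz : exists P, peirce_values P ve vf vy vz.
Proof.
have [P [[P1 Pg Px Pgx] _]] :=
  sw_values_exists (ve + vf) (ve - vf) (vy + vz) (vy - vz).
have halves (u v : H4) : 2^-1 *: (u + v) + 2^-1 *: (u - v) = u.
  by rewrite -scalerDr addrACA subrr addr0 -mulr2n -scaler_nat scalerA
    mulVf // scale1r.
have halvesB (u v : H4) : 2^-1 *: (u + v) - 2^-1 *: (u - v) = v.
  by rewrite -scalerBr opprB addrC addrA subrK -mulr2n -scaler_nat scalerA
    mulVf // scale1r.
have PE a b c d : P (peirce a b c d) = ((a + b) / 2) *: (ve + vf) +
    ((a - b) / 2) *: (ve - vf) + ((c + d) / 2) *: (vy + vz) +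
    ((c - d) / 2) *: (vy - vz).
  by rewrite /peirce swE 3!linearD 4!linearZ /= P1 Pg Px Pgx.
exists P; split; rewrite PE !(oppr0, addr0, add0r, subr0, sub0r, mul0r, mul1r,
  scale0r, mulNr, scaleNr) ?halves ?halvesB //.
Qed.

Lemma peirce_values_eval P a1 b1 c1 d1 a2 b2 c2 d2 a3 b3 c3 d3 a4 b4 c4 d4 :
  peirce_values P (peirce a1 b1 c1 d1) (peirce a2 b2 c2 d2)
                  (peirce a3 b3 c3 d3) (peirce a4 b4 c4 d4) ->
  forall a b c d, P (peirce a b c d) =
    peirce
      (a * a1 + b * a2 + c * a3 + d * a4) (a * b1 + b * b2 + c * b3 + d * b4)
      (a * c1 + b * c2 + c * c3 + d * c4) (a * d1 + b * d2 + c * d3 + d * d4).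
Proof.
move=> [Pe Pf Py Pz] a b c d.
have -> : peirce a b c d = a *: e + b *: f + c *: y + d *: z.
  by rewrite !peirceE; congr peirce; ring.
by rewrite !(linearD, linearZ) /= Pe Pf Py Pz !peirceE.
Qed.

Lemma sw_values_peirce P ve vf vy vz r1 rg rx rgx :
  peirce_values P ve vf vy vz ->
  ve + vf = r1 -> ve - vf = rg -> vy + vz = rx -> vy - vz = rgx ->
  sw_values P r1 rg rx rgx.
Proof.
move=> [<- <- <- <-] <- <- <- <-; rewrite -!linearD -!linearB.
by split; congr (P _); rewrite !(sw_mulrE, sw_oppE, sw_addE); congr sw; field.
Qed.

(** The product of the automorphism rescaling y by k and z by l with conjugation
    by 1 + j for some j in J, which sends e to e + r y + s z. *)
Lemma gauge_exists k l r s : k != 0 -> l != 0 -> exists2 phi, symmetry phi &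
  forall a b c d, phi (peirce a b c d) =
    peirce a b (k * c + r * (a - b)) (l * d + s * (a - b)).
Proof.
have gauge_op k' l' r' s' : exists phi : 'End(H4), forall a b c d,
    phi (peirce a b c d) =
    peirce a b (k' * c + r' * (a - b)) (l' * d + s' * (a - b)).
  have [phi phi_val] := peirce_values_exists (peirce 1 0 r' s')
    (peirce 0 1 (- r') (- s')) (peirce 0 0 k' 0) (peirce 0 0 0 l').
  exists phi => a b c d.
  by rewrite (peirce_values_eval phi_val); congr peirce; ring.
move=> k0 l0; have [phi phiE] := gauge_op k l r s.
have [psi psiE] := gauge_op k^-1 l^-1 (- (k^-1 * r)) (- (l^-1 * s)).
exists phi => //; left; split.
- exists psi => u; have [a [b [c [d ->]]]] := peirce_span u.
    by rewrite phiE psiE; congr peirce; field.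
  by rewrite psiE phiE; congr peirce; field.
- by rewrite peirce1E phiE; congr peirce; ring.
move=> u v; have [a [b [c [d ->]]]] := peirce_span u.
have [a' [b' [c' [d' ->]]]] := peirce_span v.
by rewrite !(peirceE, phiE); congr peirce; ring.
Qed.

Lemma swap_exists : exists2 phi : 'End(H4), symmetry phi &
  forall a b c d, phi (peirce a b c d) = peirce b a d c.
Proof.
have [phi phi_val] := peirce_values_exists f e z y.
have phiE a b c d : phi (peirce a b c d) = peirce b a d c.
  by rewrite (peirce_values_eval phi_val); congr peirce; ring.
exists phi => //; left; split.
- apply: inv_bij => u; have [a [b [c [d ->]]]] := peirce_span u.
  by rewrite !phiE.
- by rewrite peirce1E phiE.
move=> u v; have [a [b [c [d ->]]]] := peirce_span u.
have [a' [b' [c' [d' ->]]]] := peirce_span v.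
by rewrite !(peirceE, phiE); congr peirce; ring.
Qed.

Lemma flip_exists : exists2 phi : 'End(H4), symmetry phi &
  forall a b c d, phi (peirce a b c d) = peirce a b d c.
Proof.
have [phi phi_val] := peirce_values_exists e f z y.
have phiE a b c d : phi (peirce a b c d) = peirce a b d c.
  by rewrite (peirce_values_eval phi_val); congr peirce; ring.
exists phi => //; right; split.
- apply: inv_bij => u; have [a [b [c [d ->]]]] := peirce_span u.
  by rewrite !phiE.
- by rewrite peirce1E phiE.
move=> u v; have [a [b [c [d ->]]]] := peirce_span u.
have [a' [b' [c' [d' ->]]]] := peirce_span v.
by rewrite !(peirceE, phiE); congr peirce; ring.
Qed.

(** * Reduction along symmetries and duality *)

(** Trivial operators are included so that the property is closed under
    conjugation and duality without side conditions. *)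
Definition classified P := rb_trivial (-1) P \/
  exists S : 'End(H4), rb_list (-1) S /\
    (conjugate_of S P \/ conjugate_of S (rb_dual (-1) P)).

Lemma classified_dual P : classified (rb_dual (-1) P) -> classified P.
Proof.
case=> [triv | [S [S_list S_conj]]]; last first.
  right; exists S; split=> //; rewrite rb_dualK in S_conj.
  by case: S_conj; auto.
left; rewrite -(rb_dualK (-1) P); case: triv => ->; rewrite /rb_dual.
  by right; rewrite subr0.
by left; rewrite subrr.
Qed.

Lemma classified_pull phi P P' : symmetry phi ->
  (forall u, phi (P' u) = P (phi u)) -> classified P' -> classified P.
Proof.
move=> sym_phi phiP.
have ker0 := bijective_lker0 (symmetry_bij sym_phi).
have phiVK : cancel phi^-1%VF phi := lker0_lfunVK ker0.
have PE u : P u = phi (P' (phi^-1%VF u)) by rewrite phiP phiVK.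
case=> [triv | [S [S_list S_conj]]].
  left; case: triv PE => -> PE; [left | right]; apply/lfunP => u; rewrite PE.
    by rewrite !zero_lfunE linear0.
  by rewrite !(opp_lfunE, scale_lfunE, id_lfunE) linearN linearZ /= phiVK.
right; exists S; split=> //; case: S_conj => S_conj; [left | right].
  exact: conjugate_of_pull sym_phi phiP S_conj.
apply: conjugate_of_pull sym_phi _ S_conj => u.
rewrite !(add_lfunE, opp_lfunE, scale_lfunE, id_lfunE).
by rewrite linearB linearN linearZ /= phiP.
Qed.

Lemma classified_list S : rb_list (-1) S -> classified S.
Proof.
move=> S_list; right; exists S; split=> //; left.
apply: (@conjugate_of_intertwining _ _ \1%VF) => [|u];
  last by rewrite !id_lfunE.
left; split; last by move=> u v; rewrite !id_lfunE.
  by exists id => u; rewrite id_lfunE.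
by rewrite id_lfunE.
Qed.

Lemma classified_conj phi P : symmetry phi ->
  (forall P', rota_baxter (-1) P' -> (forall u, phi (P' u) = P (phi u)) ->
     classified P') ->
  rota_baxter (-1) P -> classified P.
Proof.
move=> sym_phi conj_P RB_P.
have ker0 := bijective_lker0 (symmetry_bij sym_phi).
have phiP u : phi ((phi^-1 \o P \o phi)%VF u) = P (phi u).
  by rewrite !comp_lfunE lker0_lfunVK.
apply: (classified_pull sym_phi phiP); apply: conj_P phiP.
exact: rota_baxter_conj.
Qed.

(** The conjugate of P by phi is known as soon as its four values are guessed:
    it suffices to check that phi intertwines on the basis. *)
Lemma classified_along phi P ve vf vy vz : symmetry phi ->
  P (phi e) = phi ve -> P (phi f) = phi vf ->
  P (phi y) = phi vy -> P (phi z) = phi vz ->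
  (forall P', rota_baxter (-1) P' -> peirce_values P' ve vf vy vz ->
     classified P') ->
  rota_baxter (-1) P -> classified P.
Proof.
move=> sym_phi Pe Pf Py Pz conj_P.
apply: (classified_conj sym_phi) => P' RB_P' phiP'; apply: conj_P => //.
by split; apply: (bij_inj (symmetry_bij sym_phi)); rewrite phiP'.
Qed.

Lemma classified_swap P a1 b1 c1 d1 a2 b2 c2 d2 a3 b3 c3 d3 a4 b4 c4 d4 :
  peirce_values P (peirce a1 b1 c1 d1) (peirce a2 b2 c2 d2)
                  (peirce a3 b3 c3 d3) (peirce a4 b4 c4 d4) ->
  rota_baxter (-1) P ->
  (forall P', rota_baxter (-1) P' ->
     peirce_values P' (peirce b2 a2 d2 c2) (peirce b1 a1 d1 c1)
                      (peirce b4 a4 d4 c4) (peirce b3 a3 d3 c3) ->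
     classified P') ->
  classified P.
Proof.
move=> [Pe Pf Py Pz] RB_P swapP; have [phi sym_phi phiE] := swap_exists.
by apply: classified_along sym_phi _ _ _ _ swapP RB_P; rewrite !phiE.
Qed.

Lemma classified_flip P a1 b1 c1 d1 a2 b2 c2 d2 a3 b3 c3 d3 a4 b4 c4 d4 :
  peirce_values P (peirce a1 b1 c1 d1) (peirce a2 b2 c2 d2)
                  (peirce a3 b3 c3 d3) (peirce a4 b4 c4 d4) ->
  rota_baxter (-1) P ->
  (forall P', rota_baxter (-1) P' ->
     peirce_values P' (peirce a1 b1 d1 c1) (peirce a2 b2 d2 c2)
                      (peirce a4 b4 d4 c4) (peirce a3 b3 d3 c3) ->
     classified P') ->
  classified P.
Proof.
move=> [Pe Pf Py Pz] RB_P flipP; have [phi sym_phi phiE] := flip_exists.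
by apply: classified_along sym_phi _ _ _ _ flipP RB_P; rewrite !phiE.
Qed.

Lemma classified_dual_values P
    a1 b1 c1 d1 a2 b2 c2 d2 a3 b3 c3 d3 a4 b4 c4 d4 :
  peirce_values P (peirce a1 b1 c1 d1) (peirce a2 b2 c2 d2)
                  (peirce a3 b3 c3 d3) (peirce a4 b4 c4 d4) ->
  rota_baxter (-1) P ->
  (forall Q, rota_baxter (-1) Q ->
     peirce_values Q (peirce (1 - a1) (- b1) (- c1) (- d1))
                     (peirce (- a2) (1 - b2) (- c2) (- d2))
                     (peirce (- a3) (- b3) (1 - c3) (- d3))
                     (peirce (- a4) (- b4) (- c4) (1 - d4)) ->
     classified Q) ->
  classified P.
Proof.
move=> [Pe Pf Py Pz] RB_P dualP; apply: classified_dual.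
apply: dualP (rota_baxter_dual RB_P) _.
split; rewrite !(add_lfunE, opp_lfunE, scale_lfunE, id_lfunE) ?Pe ?Pf ?Py ?Pz;
  by rewrite !peirceE; congr peirce; ring.
Qed.

(** * The members of the list in Peirce coordinates *)

Ltac sweedler_eq := rewrite ?peirce1E ?peirceE ?sw1E /sw_g /sw_x ?sw0E
  /peirce ?(sw_mulrE, sw_scaleE, sw_oppE, sw_addE);
  congr (sw _ _ _ _); by field.

Ltac by_listing ctor vP := apply: classified_list; apply: ctor;
  apply: (sw_values_peirce vP); sweedler_eq.

Lemma classified_RB1 P c : c != 0 ->
  peirce_values P (peirce 0 0 0 0) (peirce 0 0 0 0) (peirce c 0 1 0)
    (peirce 0 0 0 1) -> classified P.
Proof.
move=> c_neq0 vP; apply: classified_list; apply: (@RB1 _ _ _ (c / 2)).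
  by rewrite mulf_neq0 ?invr_eq0.
by apply: (sw_values_peirce vP); sweedler_eq.
Qed.

Lemma classified_RB12 P c : c != 0 ->
  peirce_values P (peirce 1 1 0 0) (peirce 0 0 0 0) (peirce 0 c 1 0)
    (peirce 0 0 0 1) -> classified P.
Proof.
move=> c_neq0 vP; apply: classified_list; apply: (@RB12 _ _ _ (c / 2)).
  by rewrite mulf_neq0 ?invr_eq0.
by apply: (sw_values_peirce vP); sweedler_eq.
Qed.

Lemma classified_RB2 P :
  peirce_values P (peirce 1 0 0 0) (peirce (-1) 0 0 0) (peirce 0 0 1 0)
    (peirce 0 0 (-1) 0) -> classified P.
Proof. by move=> vP; by_listing RB2 vP. Qed.

Lemma classified_RB3 P :
  peirce_values P (peirce 1 0 0 0) (peirce (-1) 0 0 0) (peirce 0 0 1 0)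
    (peirce 0 0 0 0) -> classified P.
Proof. by move=> vP; by_listing RB3 vP. Qed.

Lemma classified_RB4 P :
  peirce_values P (peirce 1 0 0 0) (peirce 0 1 0 0) (peirce 0 0 0 0)
    (peirce 0 0 0 0) -> classified P.
Proof. by move=> vP; by_listing RB4 vP. Qed.

Lemma classified_RB5 P :
  peirce_values P (peirce 1 0 0 0) (peirce 1 1 0 0) (peirce 0 0 0 0)
    (peirce 0 0 0 0) -> classified P.
Proof. by move=> vP; by_listing RB5 vP. Qed.

Lemma classified_RB6 P :
  peirce_values P (peirce 1 0 0 0) (peirce 0 0 0 0) (peirce 0 0 1 0)
    (peirce 0 0 0 0) -> classified P.
Proof. by move=> vP; by_listing RB6 vP. Qed.

Lemma classified_RB7 P :
  peirce_values P (peirce 0 (-1) 0 0) (peirce 0 0 0 0) (peirce 0 0 1 0)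
    (peirce 0 0 0 0) -> classified P.
Proof. by move=> vP; by_listing RB7 vP. Qed.

Lemma classified_RB8 P :
  peirce_values P (peirce 1 1 0 0) (peirce 0 0 0 0) (peirce 0 0 0 0)
    (peirce 0 0 0 0) -> classified P.
Proof. by move=> vP; by_listing RB8 vP. Qed.

Lemma classified_RB9 P :
  peirce_values P (peirce 1 0 0 0) (peirce 0 0 0 0) (peirce 0 0 0 0)
    (peirce 0 0 0 0) -> classified P.
Proof. by move=> vP; by_listing RB9 vP. Qed.

Lemma classified_RB10 P :
  peirce_values P (peirce 0 (-1) 0 0) (peirce 0 0 0 0) (peirce 0 0 0 0)
    (peirce 0 0 0 0) -> classified P.
Proof. by move=> vP; by_listing RB10 vP. Qed.

Lemma classified_RB11 P :
  peirce_values P (peirce 1 0 0 0) (peirce (-1) 0 0 0) (peirce 0 0 0 0)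
    (peirce 0 0 0 0) -> classified P.
Proof. by move=> vP; by_listing RB11 vP. Qed.

Lemma classified_RB13 P :
  peirce_values P (peirce 1 0 0 0) (peirce 0 1 0 0) (peirce 0 0 1 0)
    (peirce 0 0 0 0) -> classified P.
Proof. by move=> vP; by_listing RB13 vP. Qed.

Lemma classified_RB14 P :
  peirce_values P (peirce 1 0 0 0) (peirce 0 1 0 0) (peirce 0 0 0 (-1))
    (peirce 0 0 0 1) -> classified P.
Proof. by move=> vP; by_listing RB14 vP. Qed.

(** * Operators that do not preserve the radical *)

(** The shape in which one coordinate of the Rota-Baxter law is simplified: the
    difference of the two sides of the goal is that of the hypothesis. *)
Lemma eq_of_eq (s t u v : F) : s = t -> u - v = s - t -> u = v.
Proof. by move=> -> /eqP; rewrite subrr subr_eq0 => /eqP. Qed.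

Lemma idempotent_scalar (t : F) : t * t = t -> t = 0 \/ t = 1.
Proof.
move=> tt; have /eqP : t * (t - 1) = 0 by apply: (eq_of_eq tt); ring.
by rewrite mulf_eq0 subr_eq0 => /orP [] /eqP; [left | right].
Qed.

Tactic Notation "rota_baxter_at" constr(RB) constr(vP) constr(u) constr(v) :=
  have := RB u v; rewrite !(peirceE, peirce_values_eval vP) => /peirce_inj.

Ltac solve_from H := solve
  [apply: (eq_of_eq H); ring
  | apply: (eq_of_eq (esym H)); ring].

(** Once P(y) = e, the law on the pairs formed by y and one more basis element
    is linear in the other three values and leaves one free coefficient in
    P(f) and one in P(z); the law on (f, f) and (z, e) makes them idempotent. *)
Lemma unstable_normal_form P a1 b1 c1 d1 a2 b2 c2 d2 a4 b4 c4 d4 :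
  rota_baxter (-1) P ->
  peirce_values P (peirce a1 b1 c1 d1) (peirce a2 b2 c2 d2)
                  (peirce 1 0 0 0) (peirce a4 b4 c4 d4) ->
  exists t s, [/\ t = 0 \/ t = 1, s = 0 \/ s = 1 &
    peirce_values P (peirce 1 0 0 0) (peirce (t - 1) t 0 0)
                    (peirce 1 0 0 0) (peirce 0 0 0 s)].
Proof.
move=> RB_P vP.
rota_baxter_at RB_P vP z y => -[H1 H2 H3 H4].
have a40 : a4 = 0 by solve_from H1.
have b40 : b4 = 0 by solve_from H2.
have c40 : c4 = 0 by solve_from H3.
subst a4 b4 c4 => {H1 H2 H3 H4}.
rota_baxter_at RB_P vP y e => -[H1 H2 H3 H4].
have b10 : b1 = 0 by solve_from H1.
subst b1.
have d10 : d1 = 0 by solve_from H4.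
subst d1 => {H1 H2 H3 H4}.
rota_baxter_at RB_P vP e y => -[H1 H2 H3 H4].
have a11 : a1 = 1 by solve_from H1.
have c10 : c1 = 0 by solve_from H3.
subst a1 c1 => {H1 H2 H3 H4}.
rota_baxter_at RB_P vP y f => -[H1 H2 H3 H4].
have a2E : a2 = b2 - 1 by solve_from H1.
have c20 : c2 = 0 by solve_from H3.
subst a2 c2 => {H1 H2 H3 H4}.
rota_baxter_at RB_P vP f y => -[H1 H2 H3 H4].
have d20 : d2 = 0 by solve_from H4.
subst d2 => {H1 H2 H3 H4}.
rota_baxter_at RB_P vP f f => -[_ H2 _ _].
rota_baxter_at RB_P vP z e => -[_ _ _ H4].
exists b2, d4; split=> //; apply: idempotent_scalar.
  by solve_from H2.
by solve_from H4.
Qed.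

Lemma classified_values P ve vf vy vz ve' vf' vy' vz' :
  (peirce_values P ve' vf' vy' vz' -> classified P) ->
  peirce_values P ve vf vy vz ->
  ve = ve' -> vf = vf' -> vy = vy' -> vz = vz' -> classified P.
Proof. by move=> cl vP eqe eqf eqy eqz; subst; apply: cl. Qed.

(** Duality and conjugation produce coefficients such as 1 - 0 or - 0, which
    agree with those of the target lemma only up to ring identities. *)
Tactic Notation "by_values" uconstr(lem) constr(vP) :=
  refine (classified_values lem vP _ _ _ _);
  congr (peirce _ _ _ _); ring.

Lemma N1_neq0 : -1 != 0 :> F.
Proof. by rewrite oppr_eq0 oner_eq0. Qed.

(** The dual kills e and f, fixes z and sends y to y - e: this is
    RB1 with c = -1. *)
Lemma classified_unstable_id P : rota_baxter (-1) P ->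
  peirce_values P (peirce 1 0 0 0) (peirce 0 1 0 0)
                  (peirce 1 0 0 0) (peirce 0 0 0 0) -> classified P.
Proof.
move=> RB_P vP; apply: (classified_dual_values vP RB_P) => Q _ vQ.
by_values (classified_RB1 N1_neq0) vQ.
Qed.

(** The dual sends (e, f, y, z) to (0, 1, y - e, z); exchanging e with f while
    fixing y and z turns it into RB12 with c = -1. *)
Lemma classified_unstable_rank1 P : rota_baxter (-1) P ->
  peirce_values P (peirce 1 0 0 0) (peirce (-1) 0 0 0)
                  (peirce 1 0 0 0) (peirce 0 0 0 0) -> classified P.
Proof.
move=> RB_P vP; apply: (classified_dual_values vP RB_P) => Q RB_Q vQ.
apply: (classified_swap vQ RB_Q) => {Q RB_Q vQ} Q RB_Q vQ.
apply: (classified_flip vQ RB_Q) => {Q RB_Q vQ} Q RB_Q vQ.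
by_values (classified_RB12 N1_neq0) vQ.
Qed.

(** Of the four normal forms, the two with P(z) = 0 are the preceding ones; the
    two with P(z) = z are brought to them by duality followed by the
    automorphism that sends y to - y and e to e - y. *)
Lemma classified_unstable P
    a1 b1 c1 d1 a2 b2 c2 d2 a3 b3 c3 d3 a4 b4 c4 d4 :
  rota_baxter (-1) P -> a3 != 0 ->
  peirce_values P (peirce a1 b1 c1 d1) (peirce a2 b2 c2 d2)
                  (peirce a3 b3 c3 d3) (peirce a4 b4 c4 d4) ->
  classified P.
Proof.
move=> RB_P a3_neq0 vP.
rota_baxter_at RB_P vP y y => -[H1 _ _ _].
have /eqP : a3 * b3 = 0 by solve_from H1.
rewrite mulf_eq0 (negPf a3_neq0) => /eqP b30; subst b3 => {H1}.
(* This gauge sends y to a3^-1 y, whose image under P is the image of e. *)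
have [phi sym_phi phiE] := gauge_exists (c3 / a3) (d3 / a3)
  (invr_neq0 a3_neq0) (oner_neq0 F).
apply: (classified_conj sym_phi) RB_P => P' RB_P' phiP'.
have P'y : P' y = e.
  apply: (bij_inj (symmetry_bij sym_phi)); rewrite phiP' !phiE.
  by rewrite (peirce_values_eval vP); congr peirce; field.
have [a1' [b1' [c1' [d1' P'e]]]] := peirce_span (P' e).
have [a2' [b2' [c2' [d2' P'f]]]] := peirce_span (P' f).
have [a4' [b4' [c4' [d4' P'z]]]] := peirce_span (P' z).
have [t [s [t01 s01 {}vP]]] := unstable_normal_form RB_P'
  (And4 P'e P'f P'y P'z).
have [phi1 sym_phi1 phi1E] := gauge_exists (-1) 0 N1_neq0 (oner_neq0 F).
case: t01 s01 vP => -> [] -> vP.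
- by_values (classified_unstable_rank1 RB_P') vP.
- apply: (classified_dual_values vP RB_P') => Q RB_Q vQ.
  apply: (@classified_along phi1 _ (peirce 1 0 0 0) (peirce 0 1 0 0)
    (peirce 1 0 0 0) (peirce 0 0 0 0)) RB_Q => //;
    do ?by rewrite !phi1E (peirce_values_eval vQ); congr peirce; ring.
  exact: classified_unstable_id.
- by_values (classified_unstable_id RB_P') vP.
apply: (classified_dual_values vP RB_P') => Q RB_Q vQ.
apply: (@classified_along phi1 _ (peirce 1 0 0 0) (peirce (-1) 0 0 0)
    (peirce 1 0 0 0) (peirce 0 0 0 0)) RB_Q => //;
    do ?by rewrite !phi1E (peirce_values_eval vQ); congr peirce; ring.
exact: classified_unstable_rank1.
Qed.

(** * Operators that preserve the radical *)

(** If j = m y + n z, conjugation by an automorphism that sends e to e + j and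
    fixes J replaces the radical part of P(e) by itself plus P(j) - (p - q) j,
    and changes that of P(f) accordingly; the four hypotheses say that both
    become zero. *)
Lemma classified_inner_conj P m n p q r s p' q' r' s' a b c d :
  peirce_values P (peirce p q r s) (peirce p' q' r' s')
                  (peirce 0 0 a c) (peirce 0 0 b d) ->
  r = (p - q) * m - (m * a + n * b) ->
  s = (p - q) * n - (m * c + n * d) ->
  r' = (p' - q') * m + (m * a + n * b) ->
  s' = (p' - q') * n + (m * c + n * d) ->
  rota_baxter (-1) P ->
  (forall P', rota_baxter (-1) P' ->
    peirce_values P' (peirce p q 0 0) (peirce p' q' 0 0)
                     (peirce 0 0 a c) (peirce 0 0 b d) -> classified P') ->
  classified P.
Proof.
move=> vP rE sE r'E s'E RB_P straight_P.
have [phi sym_phi phiE] := gauge_exists m n (oner_neq0 F) (oner_neq0 F).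
apply: (@classified_along phi _ (peirce p q 0 0) (peirce p' q' 0 0)
  (peirce 0 0 a c) (peirce 0 0 b d)) straight_P RB_P => //;
  by rewrite !phiE (peirce_values_eval vP) ?rE ?sE ?r'E ?s'E;
  congr peirce; ring.
Qed.

(** The operator T(y) = a y + c z, T(z) = b y + d z satisfies
    T e (T - 1) = 0 = T f (T - 1), where e and f act on J as the projections to
    y and z.  Hence T is idempotent and its kernel, the image of T - 1, is
    spanned by a subset of {y, z}. *)
Lemma projection_cases (a b c d : F) :
  (a - 1) * a = 0 -> (a - 1) * c = 0 -> c * b = 0 -> c * d = 0 ->
  b * a = 0 -> (d - 1) * b = 0 -> (d - 1) * d = 0 ->
  [\/ [/\ a = 0, b = 0, c = 0 & d = 0], [/\ a = 1, b = 0, c = 0 & d = 1],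
      [/\ a = 1, b = 0 & d = 0] | [/\ a = 0, c = 0 & d = 1]].
Proof.
have zero_or1 (t : F) : (t - 1) * t = 0 -> t = 0 \/ t = 1.
  by move=> /eqP; rewrite mulf_eq0 subr_eq0 => /orP [] /eqP; [right | left].
have m1_inj (t : F) : (0 - 1) * t = 0 -> t = 0 by move=> H; solve_from H.
have one_inj (t : F) : t * 1 = 0 -> t = 0 by rewrite mulr1.
move=> /zero_or1 [] -> ac cb cd ba db /zero_or1 [] dE; rewrite dE in cd db.
- by constructor 1; split=> //; exact: m1_inj.
- by constructor 4; split=> //; exact: m1_inj.
- by constructor 3; split=> //; exact: m1_inj.
- by constructor 2; split=> //; exact: one_inj.
Qed.

(** P = 0 if T = 0, and P is the dual of RB4 if T = 1.  If T has rank one, then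
    up to exchanging y and z it kills z and fixes y modulo z: T(y) = y gives the
    dual of RB13, and otherwise rescaling z gives the dual of RB14. *)
Lemma classified_zero_diag P a b c d : rota_baxter (-1) P ->
  peirce_values P (peirce 0 0 0 0) (peirce 0 0 0 0)
                  (peirce 0 0 a c) (peirce 0 0 b d) -> classified P.
Proof.
have one_radical Q t : rota_baxter (-1) Q ->
    peirce_values Q (peirce 0 0 0 0) (peirce 0 0 0 0)
                    (peirce 0 0 1 t) (peirce 0 0 0 0) -> classified Q.
  move=> RB_Q vQ; have [t0 | t_neq0] := eqVneq t 0.
    rewrite t0 in vQ.
    apply: (classified_dual_values vQ RB_Q) => {Q RB_Q vQ} Q RB_Q vQ.
    apply: (classified_flip vQ RB_Q) => {Q RB_Q vQ} Q RB_Q vQ.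
    by_values (@classified_RB13 _) vQ.
  apply: (classified_dual_values vQ RB_Q) => {Q RB_Q vQ} Q RB_Q vQ.
  have [phi sym_phi phiE] := gauge_exists 0 0 (oner_neq0 F) t_neq0.
  apply: (@classified_along phi _ (peirce 1 0 0 0) (peirce 0 1 0 0)
    (peirce 0 0 0 (-1)) (peirce 0 0 0 1)) RB_Q => [|||||S _ vS] //;
    do ?by rewrite !phiE (peirce_values_eval vQ); congr peirce; ring.
  by_values (@classified_RB14 _) vS.
move=> RB_P vP.
rota_baxter_at RB_P vP e y => -[_ _ H1 H2].
rota_baxter_at RB_P vP f y => -[_ _ H3 H4].
rota_baxter_at RB_P vP e z => -[_ _ H5 _].
rota_baxter_at RB_P vP f z => -[_ _ H6 H7].
have [] : [\/ [/\ a = 0, b = 0, c = 0 & d = 0],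
      [/\ a = 1, b = 0, c = 0 & d = 1],
      [/\ a = 1, b = 0 & d = 0] | [/\ a = 0, c = 0 & d = 1]].
  apply: projection_cases; [solve_from H1 | solve_from H2 | solve_from H3 |
    solve_from H4 | solve_from H5 | solve_from H6 | solve_from H7].
- case=> a0 b0 c0 d0; subst; left; left; apply/lfunP => u.
  have [a [b [c [d ->]]]] := peirce_span u.
  by rewrite (peirce_values_eval vP) zero_lfunE peirce0E; congr peirce; ring.
- case=> a1 b0 c0 d1; subst.
  apply: (classified_dual_values vP RB_P) => Q RB_Q vQ.
  by_values (@classified_RB4 _) vQ.
- by case=> a1 b0 d0; subst; apply: one_radical RB_P vP.
case=> a0 c0 d1; subst.
by apply: (classified_flip vP RB_P) => Q RB_Q vQ; apply: one_radical RB_Q vQ.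
Qed.

(** T = 0 gives RB8 and T = 1 the dual of RB11.  If T has rank one, then as for
    classified_zero_diag T(y) = y + t z up to symmetry: t = 0 gives the dual of
    RB3, and otherwise rescaling z gives the dual of RB2. *)
Lemma classified_unit_diag P a b c d : rota_baxter (-1) P ->
  peirce_values P (peirce 1 1 0 0) (peirce 0 0 0 0)
                  (peirce 0 0 a c) (peirce 0 0 b d) -> classified P.
Proof.
have one_radical Q t : rota_baxter (-1) Q ->
    peirce_values Q (peirce 1 1 0 0) (peirce 0 0 0 0)
                    (peirce 0 0 1 t) (peirce 0 0 0 0) -> classified Q.
  move=> RB_Q vQ; have [t0 | t_neq0] := eqVneq t 0.
    rewrite t0 in vQ.
    apply: (classified_dual_values vQ RB_Q) => {Q RB_Q vQ} Q RB_Q vQ.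
    apply: (classified_swap vQ RB_Q) => {Q RB_Q vQ} Q RB_Q vQ.
    by_values (@classified_RB3 _) vQ.
  have [phi sym_phi phiE] := gauge_exists 0 0 (oner_neq0 F) t_neq0.
  apply: (@classified_along phi _ (peirce 1 1 0 0) (peirce 0 0 0 0)
    (peirce 0 0 1 1) (peirce 0 0 0 0)) RB_Q => [|||||S RB_S vS] //;
    do ?by rewrite !phiE (peirce_values_eval vQ); congr peirce; ring.
  apply: (classified_dual_values vS RB_S) => {S RB_S vS} S RB_S vS.
  apply: (classified_swap vS RB_S) => {S RB_S vS} S RB_S vS.
  by_values (@classified_RB2 _) vS.
move=> RB_P vP.
rota_baxter_at RB_P vP y f => -[_ _ H1 H2].
rota_baxter_at RB_P vP f y => -[_ _ H3 H4].
rota_baxter_at RB_P vP z f => -[_ _ H5 _].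
rota_baxter_at RB_P vP f z => -[_ _ H6 H7].
have [] : [\/ [/\ a = 0, b = 0, c = 0 & d = 0],
      [/\ a = 1, b = 0, c = 0 & d = 1],
      [/\ a = 1, b = 0 & d = 0] | [/\ a = 0, c = 0 & d = 1]].
  apply: projection_cases; [solve_from H1 | solve_from H2 | solve_from H3 |
    solve_from H4 | solve_from H5 | solve_from H6 | solve_from H7].
- case=> a0 b0 c0 d0; subst; by_values (@classified_RB8 _) vP.
- case=> a1 b0 c0 d1; subst.
  apply: (classified_dual_values vP RB_P) => {P RB_P vP} P RB_P vP.
  apply: (classified_swap vP RB_P) => {P RB_P vP} P RB_P vP.
  by_values (@classified_RB11 _) vP.
- by case=> a1 b0 d0; subst; apply: one_radical RB_P vP.
case=> a0 c0 d1; subst.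
by apply: (classified_flip vP RB_P) => Q RB_Q vQ; apply: one_radical RB_Q vQ.
Qed.

(** Here T commutes with e and f, hence is a diagonal idempotent: RB6 for rank
    one, RB9 or its dual otherwise. *)
Lemma classified_proj_diag P a b c d : rota_baxter (-1) P ->
  peirce_values P (peirce 1 0 0 0) (peirce 0 0 0 0)
                  (peirce 0 0 a c) (peirce 0 0 b d) -> classified P.
Proof.
move=> RB_P vP.
rota_baxter_at RB_P vP e y => -[_ _ H1 H2].
rota_baxter_at RB_P vP y f => -[_ _ _ H3].
rota_baxter_at RB_P vP z e => -[_ _ H4 H5].
rota_baxter_at RB_P vP f z => -[_ _ H6 _].
have ac0 : a * c = 0 by solve_from H2.
have c0 : c = 0.
  have : (a - 1) * c = 0 by solve_from H3.
  by rewrite mulrBl ac0 mul1r sub0r => /eqP; rewrite oppr_eq0 => /eqP.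
have db0 : d * b = 0 by solve_from H4.
have b0 : b = 0.
  have : (d - 1) * b = 0 by solve_from H6.
  by rewrite mulrBl db0 mul1r sub0r => /eqP; rewrite oppr_eq0 => /eqP.
have /idempotent_scalar a01 : a * a = a by solve_from H1.
have /idempotent_scalar d01 : d * d = d by solve_from H5.
case: a01 d01 => aE [] dE; subst.
- by_values (@classified_RB9 _) vP.
- apply: (classified_flip vP RB_P) => Q RB_Q vQ.
  by_values (@classified_RB6 _) vQ.
- by_values (@classified_RB6 _) vP.
apply: (classified_dual_values vP RB_P) => Q RB_Q vQ.
apply: (classified_swap vQ RB_Q) => S RB_S vS.
by_values (@classified_RB9 _) vS.
Qed.

(** Again T is a diagonal idempotent: RB5 for T = 0, and the duals of RB7 and
    RB10 for ranks one and two. *)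
Lemma classified_upper_diag P a b c d : rota_baxter (-1) P ->
  peirce_values P (peirce 1 1 0 0) (peirce 0 1 0 0)
                  (peirce 0 0 a c) (peirce 0 0 b d) -> classified P.
Proof.
move=> RB_P vP.
rota_baxter_at RB_P vP e y => -[_ _ H1 H2].
rota_baxter_at RB_P vP y f => -[_ _ _ H3].
rota_baxter_at RB_P vP z e => -[_ _ H4 H5].
rota_baxter_at RB_P vP f z => -[_ _ H6 _].
have c0 : c = 0 by apply: etrans (_ : a * c = _);
  [solve_from H2 | solve_from H3].
have b0 : b = 0 by apply: etrans (_ : d * b = _);
  [solve_from H4 | solve_from H6].
have /idempotent_scalar a01 : a * a = a by solve_from H1.
have /idempotent_scalar d01 : d * d = d by solve_from H5.
case: a01 d01 => aE [] dE; subst.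
- apply: (classified_swap vP RB_P) => Q RB_Q vQ.
  by_values (@classified_RB5 _) vQ.
- apply: (classified_dual_values vP RB_P) => Q RB_Q vQ.
  by_values (@classified_RB7 _) vQ.
- apply: (classified_dual_values vP RB_P) => Q RB_Q vQ.
  apply: (classified_flip vQ RB_Q) => S RB_S vS.
  by_values (@classified_RB7 _) vS.
apply: (classified_dual_values vP RB_P) => Q RB_Q vQ.
by_values (@classified_RB10 _) vQ.
Qed.

(** The radical parts j1 of P(e) and j2 of P(f) are fixed by T, by the law on
    (e, e) and (f, f); the law on (1, 1) gives 2 T(j1 + j2) = j1 + j2, so
    j1 + j2 = 0.  Hence conjugation with j = - j1 removes both. *)
Lemma classified_zero P r s r' s' a b c d : rota_baxter (-1) P ->
  peirce_values P (peirce 0 0 r s) (peirce 0 0 r' s')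
                  (peirce 0 0 a c) (peirce 0 0 b d) -> classified P.
Proof.
move=> RB_P vP.
rota_baxter_at RB_P vP e e => -[_ _ H1 H2].
have Tr : r * a + s * b = r by solve_from H1.
have Ts : r * c + s * d = s by solve_from H2.
rota_baxter_at RB_P vP f f => -[_ _ H3 H4].
have Tr' : r' * a + s' * b = r' by solve_from H3.
have Ts' : r' * c + s' * d = s' by solve_from H4.
rota_baxter_at RB_P vP (peirce 1 1 0 0) (peirce 1 1 0 0) => -[_ _ H5 H6].
have r'E : r' = - r.
  have rr' : r + r' =
    2 * ((r * a + s * b) + (r' * a + s' * b)) by solve_from H5.
  by rewrite Tr Tr' in rr'; solve_from rr'.
have s'E : s' = - s.
  have ss' : s + s' =
    2 * ((r * c + s * d) + (r' * c + s' * d)) by solve_from H6.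
  by rewrite Ts Ts' in ss'; solve_from ss'.
have Tm : (- r) * a + (- s) * b = - (r * a + s * b) by ring.
have Tn : (- r) * c + (- s) * d = - (r * c + s * d) by ring.
apply: (classified_inner_conj (m := - r) (n := - s) vP) RB_P _
  => [||||P' RB_P' vP'];
  rewrite ?Tm ?Tn ?Tr ?Ts ?Tr' ?Ts' ?r'E ?s'E; try ring.
exact: classified_zero_diag RB_P' vP'.
Qed.

(** Here T(j1) = 0 and T(j2) = j2, so that j = j1 + j2 satisfies
    j - T(j) = j1 and T(j) = j2. *)
Lemma classified_proj P r s r' s' a b c d : rota_baxter (-1) P ->
  peirce_values P (peirce 1 0 r s) (peirce 0 0 r' s')
                  (peirce 0 0 a c) (peirce 0 0 b d) -> classified P.
Proof.
move=> RB_P vP.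
rota_baxter_at RB_P vP e e => -[_ _ H1 H2].
have Tr : r * a + s * b = 0 by solve_from H1.
have Ts : r * c + s * d = 0 by solve_from H2.
rota_baxter_at RB_P vP f f => -[_ _ H3 H4].
have Tr' : r' * a + s' * b = r' by solve_from H3.
have Ts' : r' * c + s' * d = s' by solve_from H4.
have Tm : (r + r') * a + (s + s') * b =
    (r * a + s * b) + (r' * a + s' * b) by ring.
have Tn : (r + r') * c + (s + s') * d =
    (r * c + s * d) + (r' * c + s' * d) by ring.
apply: (classified_inner_conj (m := r + r') (n := s + s') vP) RB_P _
  => [||||P' RB_P' vP'];
  rewrite ?Tm ?Tn ?Tr ?Ts ?Tr' ?Ts'; try ring.
exact: classified_proj_diag RB_P' vP'.
Qed.

(** As for classified_zero, j1 and j2 are fixed by T and j1 + j2 = 0; now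
    j = j2. *)
Lemma classified_unit P r s r' s' a b c d : rota_baxter (-1) P ->
  peirce_values P (peirce 1 1 r s) (peirce 0 0 r' s')
                  (peirce 0 0 a c) (peirce 0 0 b d) -> classified P.
Proof.
move=> RB_P vP.
rota_baxter_at RB_P vP e e => -[_ _ H1 H2].
have Tr : r * a + s * b = r by solve_from H1.
have Ts : r * c + s * d = s by solve_from H2.
rota_baxter_at RB_P vP f f => -[_ _ H3 H4].
have Tr' : r' * a + s' * b = r' by solve_from H3.
have Ts' : r' * c + s' * d = s' by solve_from H4.
rota_baxter_at RB_P vP (peirce 1 1 0 0) (peirce 1 1 0 0) => -[_ _ H5 H6].
have r'E : r' = - r.
  have rr' : r + r' =
    2 * ((r * a + s * b) + (r' * a + s' * b)) by solve_from H5.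
  by rewrite Tr Tr' in rr'; solve_from rr'.
have s'E : s' = - s.
  have ss' : s + s' =
    2 * ((r * c + s * d) + (r' * c + s' * d)) by solve_from H6.
  by rewrite Ts Ts' in ss'; solve_from ss'.
apply: (classified_inner_conj (m := r') (n := s') vP) RB_P _
  => [||||P' RB_P' vP'];
  rewrite ?Tr ?Ts ?Tr' ?Ts' ?r'E ?s'E; try ring.
exact: classified_unit_diag RB_P' vP'.
Qed.

(** Here T(j1) = j1 and T(j2) = 0; the radical parts are removed by
    j = - (j1 + j2). *)
Lemma classified_upper P r s r' s' a b c d : rota_baxter (-1) P ->
  peirce_values P (peirce 1 1 r s) (peirce 0 1 r' s')
                  (peirce 0 0 a c) (peirce 0 0 b d) -> classified P.
Proof.
move=> RB_P vP.
rota_baxter_at RB_P vP e e => -[_ _ H1 H2].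
have Tr : r * a + s * b = r by solve_from H1.
have Ts : r * c + s * d = s by solve_from H2.
rota_baxter_at RB_P vP f f => -[_ _ H3 H4].
have Tr' : r' * a + s' * b = 0 by solve_from H3.
have Ts' : r' * c + s' * d = 0 by solve_from H4.
have Tm : (- (r + r')) * a + (- (s + s')) * b =
    - ((r * a + s * b) + (r' * a + s' * b)) by ring.
have Tn : (- (r + r')) * c + (- (s + s')) * d =
    - ((r * c + s * d) + (r' * c + s' * d)) by ring.
apply: (classified_inner_conj (m := - (r + r')) (n := - (s + s')) vP) RB_P _
  => [||||P' RB_P' vP'];
  rewrite ?Tm ?Tn ?Tr ?Ts ?Tr' ?Ts'; try ring.
exact: classified_upper_diag RB_P' vP'.
Qed.

(** * The classification *)

Lemma classified_stable_fix_e P q r s q' r' s' a b c d :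
  rota_baxter (-1) P ->
  peirce_values P (peirce 1 q r s) (peirce 0 q' r' s')
                  (peirce 0 0 a c) (peirce 0 0 b d) -> classified P.
Proof.
move=> RB_P vP.
rota_baxter_at RB_P vP e e => -[_ H1 _ _].
have /idempotent_scalar q01 : q * q = q by solve_from H1.
rota_baxter_at RB_P vP f f => -[_ H2 _ _].
have /idempotent_scalar q'01 : q' * q' = q' by solve_from H2.
clear H1 H2; case: q01 q'01 => qE [] q'E; subst.
- exact: classified_proj RB_P vP.
- apply: (classified_dual_values vP RB_P) => Q RB_Q vQ.
  by_values (classified_zero RB_Q) vQ.
- exact: classified_unit RB_P vP.
exact: classified_upper RB_P vP.
Qed.

Lemma classified_stable_triangular P p q r s q' r' s' a b c d :
  rota_baxter (-1) P ->
  peirce_values P (peirce p q r s) (peirce 0 q' r' s')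
                  (peirce 0 0 a c) (peirce 0 0 b d) -> classified P.
Proof.
move=> RB_P vP.
rota_baxter_at RB_P vP e e => -[H1 _ _ _].
have /idempotent_scalar p01 : p * p = p by solve_from H1.
clear H1; case: p01 => pE; subst; last exact: classified_stable_fix_e RB_P vP.
apply: (classified_dual_values vP RB_P) => Q RB_Q vQ.
by_values (classified_stable_fix_e RB_Q) vQ.
Qed.

(** The law on (e, f) forces q p' = 0: the induced operator on F x F is
    triangular, and exchanging e with f makes p' vanish. *)
Lemma classified_stable P p q r s p' q' r' s' a b c d :
  rota_baxter (-1) P ->
  peirce_values P (peirce p q r s) (peirce p' q' r' s')
                  (peirce 0 0 a c) (peirce 0 0 b d) -> classified P.
Proof.
move=> RB_P vP.
rota_baxter_at RB_P vP e f => -[H1 _ _ _].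
have /eqP : q * p' = 0 by solve_from H1.
clear H1; rewrite mulf_eq0 => /orP [] /eqP qp'0; subst; last first.
  exact: classified_stable_triangular RB_P vP.
apply: (classified_swap vP RB_P) => P' RB_P' vP'.
exact: classified_stable_triangular RB_P' vP'.
Qed.

(** The symmetries act transitively on the four coordinates of P(y) and P(z)
    along e and f, so a nonzero one can be moved to the coordinate of P(y)
    along e. *)
Lemma rota_baxter_classified P : rota_baxter (-1) P -> classified P.
Proof.
move=> RB_P.
have [a1 [b1 [c1 [d1 Pe]]]] := peirce_span (P e).
have [a2 [b2 [c2 [d2 Pf]]]] := peirce_span (P f).
have [a3 [b3 [c3 [d3 Py]]]] := peirce_span (P y).
have [a4 [b4 [c4 [d4 Pz]]]] := peirce_span (P z).
have {Pe Pf Py Pz} vP := And4 Pe Pf Py Pz.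
have [a3_0 | a3_neq0] := eqVneq a3 0; last first.
  exact: classified_unstable RB_P a3_neq0 vP.
have [a4_0 | a4_neq0] := eqVneq a4 0; last first.
  apply: (classified_flip vP RB_P) => P' RB_P' vP'.
  exact: classified_unstable RB_P' a4_neq0 vP'.
have [b4_0 | b4_neq0] := eqVneq b4 0; last first.
  apply: (classified_swap vP RB_P) => P' RB_P' vP'.
  exact: classified_unstable RB_P' b4_neq0 vP'.
have [b3_0 | b3_neq0] := eqVneq b3 0; last first.
  apply: (classified_flip vP RB_P) => {P RB_P vP} P RB_P vP.
  apply: (classified_swap vP RB_P) => P' RB_P' vP'.
  exact: classified_unstable RB_P' b3_neq0 vP'.
by subst; apply: classified_stable RB_P vP.
Qed.

(** * The list for an arbitrary weight *)

Lemma rb_list_scale k lambda S : k != 0 ->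
  rb_list lambda S -> rb_list (k * lambda) (k *: S).
Proof.
move=> k_neq0; case=> [alpha alpha_neq0|||||||||||alpha alpha_neq0||]
  [S1 Sg Sx Sgx];
  [apply: (@RB1 _ _ _ (k * alpha)); rewrite ?mulf_neq0 // |
   apply: RB2 | apply: RB3 | apply: RB4 | apply: RB5 | apply: RB6 | apply: RB7 |
   apply: RB8 | apply: RB9 | apply: RB10 | apply: RB11 |
   apply: (@RB12 _ _ _ (k * alpha)); rewrite ?mulf_neq0 // |
   apply: RB13 | apply: RB14]; split;
  rewrite scale_lfunE (S1, Sg, Sx, Sgx);
  sweedler_eq.
Qed.

Lemma sw_values_eval S a1 b1 c1 d1 a2 b2 c2 d2 a3 b3 c3 d3 a4 b4 c4 d4 :
  sw_values S (sw a1 b1 c1 d1) (sw a2 b2 c2 d2)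
              (sw a3 b3 c3 d3) (sw a4 b4 c4 d4) ->
  forall a b c d, S (sw a b c d) =
    sw (a * a1 + b * a2 + c * a3 + d * a4) (a * b1 + b * b2 + c * b3 + d * b4)
       (a * c1 + b * c2 + c * c3 + d * c4) (a * d1 + b * d2 + c * d3 + d * d4).
Proof.
move=> [S1 Sg Sx Sgx] a b c d.
rewrite swE 3!linearD 4!linearZ /= S1 Sg Sx Sgx !(sw_scaleE, sw_addE).
by congr sw.
Qed.

Lemma rb_list_rota_baxter lambda S : rb_list lambda S -> rota_baxter lambda S.
Proof.
case=> [alpha _|||||||||||alpha _||] vS u v;
  have [a [b [c [d ->]]]] := swP u; have [a' [b' [c' [d' ->]]]] := swP v;
  rewrite ?sw1E /sw_g /sw_x ?sw0E
    ?(sw_mulrE, sw_scaleE, sw_oppE, sw_addE) in vS;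
  (* Products are evaluated before sums and before the outer S: the other
     rules would match them by unfolding the multiplication. *)
  rewrite (sw_values_eval vS a b c d) (sw_values_eval vS a' b' c' d')
    !sw_mulrE !sw_scaleE !sw_addE (sw_values_eval vS);
  congr (sw _ _ _ _); by field.
Qed.

End PeirceCoordinates.

Theorem mainTheorem1 (F : fieldType) (charF : 2%N \notin [pchar F])
    (lambda : F) (lambda_neq0 : lambda != 0) :
  (forall R : 'End(sweedler F), rb_list lambda R -> rota_baxter lambda R)
  /\
  (forall R : 'End(sweedler F),
     rota_baxter lambda R -> ~ rb_trivial lambda R ->
     exists S : 'End(sweedler F), rb_list lambda S /\
       (conjugate_of S R \/ conjugate_of S (rb_dual lambda R))).
Proof.
have two_neq0 : 2 != 0 :> F by rewrite inE /= in charF.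
split=> [R | R RB_R nontriv_R]; first exact: rb_list_rota_baxter.
have unscale : - lambda * -1 = lambda by rewrite mulrN1 opprK.
have unscaleR : - lambda *: ((- lambda^-1) *: R) = R.
  by rewrite scalerA mulrNN mulfV // scale1r.
have : rota_baxter (-1) ((- lambda^-1) *: R).
  by rewrite -(mulVf lambda_neq0) -mulNr; apply: rota_baxter_scale.
case/(rota_baxter_classified two_neq0) => [triv_R | [S [S_list S_conj]]].
  by case: nontriv_R; rewrite -unscale -unscaleR; apply: rb_trivial_scale.
exists (- lambda *: S); split.
  by rewrite -[X in rb_list X]unscale; apply: rb_list_scale;
    rewrite // oppr_eq0.
case: S_conj => /(conjugate_of_scale (- lambda)); rewrite -?rb_dual_scale.
  by rewrite unscaleR; left.
by rewrite unscaleR unscale; right.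
Qed.
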